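(* Let $E$ be a Banach space, let $\Lambda$ be a well ordered subset of a real interval $[a,b)$, $-\infty<a<b\le\infty$, with $\min\Lambda=a$ and $\sup\Lambda=b$, such that $[a,b)$ is the union of the disjoint intervals $[\alpha,S(\alpha))$, $\alpha\in\Lambda$. Given a family $(z_\alpha)_{\alpha\in\Lambda}$ in $E$, let $g:[a,b]\to E$ satisfy $g(t)=z_\alpha$ for $t\in[\alpha,S(\alpha))$, $\alpha\in\Lambda$. (a) If $b<\infty$, then $g$ is Riemann integrable on $[a,b]$ if and only if the family $(z_\alpha)_{\alpha\in\Lambda}$ is bounded. (b) If $b=\infty$, the improper Riemann integral of $g$ over $[a,b]$ exists if and only if the family $(z_\alpha)_{\alpha\in\Lambda^{<\gamma}}$ is bounded for every $\gamma\in\Lambda$, and the family $((S(\alpha)-\alpha)z_\alpha)_{\alpha\in\Lambda}$ is summable.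
   Context: A subset $\Lambda$ of $\mathbb R\cup\{\infty\}$ is well ordered if each of its nonempty subsets has a smallest element. For $\beta\in\Lambda$ different from a possible maximum of $\Lambda$, $S(\beta)$ is the smallest element of $\Lambda$ greater than $\beta$ (the successor of $\beta$). $\Lambda^{<\gamma}=\{\alpha\in\Lambda:\alpha<\gamma\}$. A family $(x_\alpha)_{\alpha\in\Lambda}$ in $E$, with $a=\min\Lambda$, $b=\sup\Lambda$, is summable if to every $\gamma\in\Lambda\cup\{b\}$ there corresponds a unique element $\sigma(\gamma)\in E$ such that: (i) $\sigma(a)=0$, and if $\gamma=S(\beta)$ for some $\beta\in\Lambda$, then $\sigma(\gamma)=\sigma(\beta)+x_\beta$; (ii) if $\gamma>a$ is not a successor, then for each $\epsilon>0$ there is $\beta_\epsilon\in\Lambda^{<\gamma}$ such that $\|\sigma(\beta)-\sigma(\gamma)\|<\epsilon$ whenever $\beta\in\Lambda$ and $\beta_\epsilon\le\beta<\gamma$. A mapping $g:[a,c]\to E$ ($-\infty<a<c<\infty$) is Riemann integrable if there is $f:[a,c]\to E$ such that for each $\epsilon>0$ there is a constant $\delta>0$ such that whenever $a=t_0<\dots<t_m=c$ and $\xi_i\in[t_{i-1},t_i]\subset(\xi_i-\delta,\xi_i+\delta)$ for all $i$, then $\left\|\sum_{i=1}^m(f(t_i)-f(t_{i-1})-g(\xi_i)(t_i-t_{i-1}))\right\|<\epsilon$; then $\int_a^cg(s)\,ds:=f(c)-f(a)$. The improper Riemann integral of $g$ over $[a,\infty]$ exists if $g$ is Riemann integrable on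 $[a,c]$ for every $c\in(a,\infty)$ and $\lim_{c\to\infty}\int_a^cg(s)\,ds$ exists in $E$. *)

(* Defs.v *)
From HB Require Import structures.
From mathcomp Require Import all_boot all_order all_algebra.
From mathcomp Require Import all_classical all_reals all_analysis.
Import Order.TTheory GRing.Theory Num.Theory.
Import numFieldNormedType.Exports.

Set Implicit Arguments.
Unset Strict Implicit.
Unset Printing Implicit Defensive.

Local Open Scope classical_set_scope.
Local Open Scope ring_scope.

Section WellOrdered.
Context {d : Order.disp_t} {T : orderType d}.
Implicit Types (L : set T) (beta gamma : T).

Definition is_least L gamma : Prop := L gamma /\ lbound L gamma.

Definition well_ordered L : Prop :=
  forall A, A `<=` L -> A !=set0 -> exists m, is_least A m.

Definition is_succ L beta gamma : Prop :=
  is_least (L `&` [set alpha | (beta < alpha)%O]) gamma.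

(* Only meaningful when [L] has an element above [beta]; otherwise it is [beta],
   so that [beta] counts as its own successor. *)
Definition succ_in L beta : T := xget beta (is_succ L beta).

End WellOrdered.

Section Summability.
Context {R : realType} {E : normedModType R}.
Implicit Types (L : set (\bar R)) (x : R -> E) (sigma : \bar R -> E).

(* [L] is meant to be a subset of R `|` {+oo}. Families are indexed by real
   numbers only: if +oo is in [L], it is the maximum of [L], so its term never
   enters a sum. For nonempty
   well-ordered [L], [ereal_inf L] is the minimum of [L]. Only the values of
   [sigma] on [L] and at [ereal_sup L] matter. *)
Definition transfinite_sums L x sigma : Prop :=
  [/\ sigma (ereal_inf L) = 0,
      forall (beta : R) (gamma : \bar R),
        L beta%:E -> is_succ L beta%:E gamma ->
        sigma gamma = sigma beta%:E + x beta
    & forall gamma : \bar R,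
        (L `|` [set ereal_sup L]) gamma ->
        (ereal_inf L < gamma)%E ->
        ~ (exists2 beta, L beta & is_succ L beta gamma) ->
        forall eps : R, 0 < eps ->
        exists beta_eps : \bar R, [/\ L beta_eps, (beta_eps < gamma)%E
          & forall beta : \bar R, L beta -> (beta_eps <= beta < gamma)%E ->
            `|sigma beta - sigma gamma| < eps]].

Definition wo_summable L x : Prop :=
  exists2 sigma, transfinite_sums L x sigma
    & forall sigma', transfinite_sums L x sigma' ->
      {in L `|` [set ereal_sup L], sigma' =1 sigma}.

End Summability.

Section RiemannIntegral.
Context {R : realType} {E : normedModType R}.
Implicit Types (a c : R) (g f : R -> E).

Definition riemann_primitive a c g f : Prop :=
  forall eps : R, 0 < eps -> exists2 delta : R, 0 < delta &
  forall (m : nat) (t xi : nat -> R),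
    t 0%N = a -> t m = c ->
    (forall i, (i < m)%N ->
      [/\ t i < t i.+1, t i <= xi i <= t i.+1
        & xi i - delta < t i /\ t i.+1 < xi i + delta]) ->
    `|\sum_(i < m) (f (t i.+1) - f (t i) - (t i.+1 - t i) *: g (xi i))| < eps.

Definition riemann_integrable a c g : Prop := exists f, riemann_primitive a c g f.

Definition riemann_integral a c g : E :=
  xget 0 [set f c - f a | f in riemann_primitive a c g].

Definition improper_riemann_integrable a g : Prop :=
  (forall c, a < c -> riemann_integrable a c g) /\
  cvg (riemann_integral a c g @[c --> +oo]).

End RiemannIntegral.

(* Main.v *)
Require Import Defs.
From HB Require Import structures.
From mathcomp Require Import all_boot all_order all_algebra.
From mathcomp Require Import all_classical all_reals all_analysis.
From mathcomp Require Import ring lra.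
Import Order.TTheory GRing.Theory Num.Theory.
Import numFieldNormedType.Exports.

Set Implicit Arguments.
Unset Strict Implicit.
Unset Printing Implicit Defensive.

Local Open Scope classical_set_scope.
Local Open Scope ring_scope.

(** The transfinite bookkeeping of the cells [[alpha, succ_in L alpha[] enters
    the integrability question only through one property of [g]: it is right locally
    constant, that is, to the right of every point [t < b] there is a short interval
    [[t, s[] on which it takes the value [g t].

    Because the increments of a primitive telescope over a partition, Riemann
    integrability on [[a, c]] says that the Riemann sums converge along the filter of
    finer and finer tagged partitions ([riemann_primitiveE]); so limits of sums, the
    Cauchy criterion and uniqueness of limits apply. An integrable function is
    bounded, since a single tag can be moved at will
    ([riemann_integrable_bounded]). Conversely a bounded right locally constant
    function is integrable ([right_locally_constant_integrable]): its truncations to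
    the left of [s] are integrable for every [s], by induction along the
    real interval [[a, c]] instead of along the well ordered set. This is part (a).

    For part (b), write [I c] for the integral over [[a, c]]. On a cell, [I] is affine
    with slope [z alpha], and [I] is locally Lipschitz when [g] is locally bounded
    ([le_integral_dist]). Hence [I], restricted to [L], satisfies the recursion and the
    limit condition that define the transfinite sums of the family
    [(succ_in L alpha - alpha) *: z alpha] ([integral_sum_at]). These conditions have
    at most one solution, by looking at the least index where two solutions would
    differ ([eq_transfinite_sum]). So summability of the family means that [I alpha]
    converges as [alpha] tends to infinity within [L]; as [I] is affine on
    the cells, this is the same as convergence of [I c] for real [c]. *)

(** * Riemann sums along fine tagged partitions *)

Record tagged_partition (R : Type) := TaggedPartition
  { tp_size : nat; tp_node : nat -> R; tp_tag : nat -> R }.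
Arguments TaggedPartition {R}.
Arguments tp_size {R}.
Arguments tp_node {R}.
Arguments tp_tag {R}.

Definition is_fine {R : realType} (a c delta : R) (p : tagged_partition R) : Prop :=
  [/\ tp_node p 0%N = a, tp_node p (tp_size p) = c &
      forall i, (i < tp_size p)%N ->
      [/\ tp_node p i < tp_node p i.+1,
          tp_node p i <= tp_tag p i <= tp_node p i.+1
        & tp_tag p i - delta < tp_node p i
          /\ tp_node p i.+1 < tp_tag p i + delta]].

(** Convergence along this filter is the limit of Riemann sums for a uniform mesh. *)
Definition fine_filter {R : realType} (a c : R) : set_system (tagged_partition R) :=
  filter_from [set delta | 0 < delta] (fun delta => is_fine a c delta).

Definition riemann_sum {R : realType} {E : lmodType R} (g : R -> E)
    (p : tagged_partition R) : E :=
  \sum_(i < tp_size p) (tp_node p i.+1 - tp_node p i) *: g (tp_tag p i).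

Definition left_tagged {R : realType} (a h : R) (N : nat) : tagged_partition R :=
  TaggedPartition N (fun i => a + i%:R * h) (fun i => a + i%:R * h).

Section RiemannSums.
Context {R : realType}.
Implicit Types (a c h delta : R) (p : tagged_partition R).

Lemma fine_le a c delta delta' p :
  delta <= delta' -> is_fine a c delta p -> is_fine a c delta' p.
Proof.
move=> dd' [p0 pm pi]; split => // i /pi[? ? [? ?]]; split => //; split; lra.
Qed.

Global Instance fine_filter_filter a c : Filter (fine_filter a c).
Proof.
apply: filter_from_filter; first by exists 1 => /=.
move=> d d' /= d0 d'0; exists (Num.min d d'); first by rewrite /= lt_min d0.
by move=> p pf; split; apply: fine_le pf; rewrite ge_min lexx ?orbT.
Qed.

Lemma fine_sorted a c delta p : is_fine a c delta p ->
  forall i j, (i <= j <= tp_size p)%N -> tp_node p i <= tp_node p j.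
Proof.
move=> [_ _ pi] i; elim=> [|j IH] /andP[ij jm].
  by move: ij; rewrite leqn0 => /eqP ->.
move: ij; rewrite leq_eqVlt => /orP[/eqP -> //|ij].
apply: (@le_trans _ _ (tp_node p j)); first by apply: IH; rewrite -ltnS ij ltnW.
by have [/ltW] := pi j jm.
Qed.

Lemma fine_node a c delta p : is_fine a c delta p ->
  forall i, (i <= tp_size p)%N -> a <= tp_node p i <= c.
Proof.
move=> pf i im; have [<- <- _] := pf.
by rewrite !(fine_sorted pf) ?leqnn ?leq0n ?im.
Qed.

Lemma fine_tag a c delta p : is_fine a c delta p ->
  forall i, (i < tp_size p)%N -> a <= tp_tag p i <= c.
Proof.
move=> pf i im; have [_ _ /(_ i im)[_ /andP[h1 h2] _]] := pf.
have /andP[h3 _] := fine_node pf (ltnW im).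
have /andP[_ h4] := fine_node pf im.
by rewrite (le_trans h3 h1) (le_trans h2 h4).
Qed.

Lemma fine_length a c delta p : is_fine a c delta p ->
  \sum_(i < tp_size p) (tp_node p i.+1 - tp_node p i) = c - a.
Proof.
move=> [<- <- _].
by rewrite -(big_mkord xpredT (fun i => tp_node p i.+1 - tp_node p i)) telescope_sumr.
Qed.

Lemma fine_equidistant a c h delta (N : nat) (xi : nat -> R) :
  0 < h < delta -> a + N%:R * h = c ->
  (forall i, (i < N)%N -> a + i%:R * h <= xi i <= a + i.+1%:R * h) ->
  is_fine a c delta (TaggedPartition N (fun i => a + i%:R * h) xi).
Proof.
move=> /andP[h0 hd] hN hxi; split => //=; first by rewrite mul0r addr0.
move=> i /hxi; rewrite -natr1 => /andP[? ?]; split; [lra|apply/andP; split; lra|split; lra].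
Qed.

Lemma fine_step a c delta : a < c -> 0 < delta ->
  exists (N : nat) h, 0 < h < delta /\ a + N%:R * h = c.
Proof.
move=> ac d0; pose N := (Num.trunc ((c - a) / delta)).+1.
have N0 : 0 < N%:R :> R by rewrite ltr0n.
exists N, ((c - a) / N%:R); split; last by rewrite mulrC divfK ?gt_eqF//; lra.
rewrite divr_gt0 ?subr_gt0//= ltr_pdivrMr// mulrC -ltr_pdivrMr//.
by have /andP[] := truncn_itv (divr_ge0 (ltW (etrans (subr_gt0 _ _) ac)) (ltW d0)).
Qed.

Lemma fine_left_tagged a c delta : a < c -> 0 < delta ->
  exists (N : nat) h, is_fine a c delta (left_tagged a h N).
Proof.
move=> ac d0; have [N [h [h0d hN]]] := fine_step ac d0.
exists N, h; apply: fine_equidistant => // i _; rewrite lexx /= -natr1.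
by move: h0d => /andP[? ?]; lra.
Qed.

Lemma fine_filter_proper a c : a < c -> ProperFilter (fine_filter a c).
Proof.
move=> ac; apply: (@filter_from_proper _ _ _ _ (fine_filter_filter a c)).
by move=> d /= d0; have [N [h ?]] := fine_left_tagged ac d0; exists (left_tagged a h N).
Qed.

End RiemannSums.

Section SumEstimates.
Context {R : realType} {E : normedModType R}.
Implicit Types (g h : R -> E) (a c delta : R) (p : tagged_partition R).

Lemma riemann_sumD g h p :
  riemann_sum (g \+ h) p = riemann_sum g p + riemann_sum h p.
Proof. by rewrite -big_split; apply: eq_bigr => i _; rewrite scalerDr. Qed.

Lemma riemann_sumB g h p :
  riemann_sum (g \- h) p = riemann_sum g p - riemann_sum h p.
Proof. by rewrite -sumrB; apply: eq_bigr => i _; rewrite scalerBr. Qed.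

Lemma riemann_sumZ (k : R -> R^o) (w : E) p :
  riemann_sum (fun x => k x *: w) p = riemann_sum k p *: w.
Proof. by rewrite scaler_suml; apply: eq_bigr => i _; rewrite scalerA. Qed.

Lemma riemann_sum_cst (w : E) a c delta p : is_fine a c delta p ->
  riemann_sum (cst w) p = (c - a) *: w.
Proof. by move=> pf; rewrite /riemann_sum -scaler_suml (fine_length pf). Qed.

Lemma eq_riemann_sum g h a c delta p : is_fine a c delta p ->
  (forall t, a <= t <= c -> g t = h t) -> riemann_sum g p = riemann_sum h p.
Proof.
by move=> pf gh; apply: eq_bigr => i _; rewrite gh// (fine_tag pf).
Qed.

Lemma le_norm_riemann_sum g (k : R -> R^o) a c delta p : is_fine a c delta p ->
  (forall i, (i < tp_size p)%N -> `|g (tp_tag p i)| <= k (tp_tag p i)) ->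
  `|riemann_sum g p| <= riemann_sum k p.
Proof.
move=> [_ _ pi] gk; apply: (le_trans (ler_norm_sum _ _ _)); apply: ler_sum => i _.
have [ti _ _] := pi i (ltn_ord i).
rewrite normrZ gtr0_norm ?subr_gt0//; apply: ler_pM; rewrite ?subr_ge0 ?(ltW ti)//.
exact: gk.
Qed.

(** The increments of [f] telescope, so only [f c - f a] matters: a primitive in this
    sense is just a candidate for the value of the integral. *)
Lemma riemann_primitiveE a c g (f : R -> E) : riemann_primitive a c g f <->
  riemann_sum g p @[p --> fine_filter a c] --> f c - f a.
Proof.
have sumE p delta : is_fine a c delta p ->
    \sum_(i < tp_size p) (f (tp_node p i.+1) - f (tp_node p i)
      - (tp_node p i.+1 - tp_node p i) *: g (tp_tag p i))
    = f c - f a - riemann_sum g p.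
  move=> [<- <- _]; rewrite sumrB; congr (_ - _).
  rewrite -(big_mkord xpredT (fun i => f (tp_node p i.+1) - f (tp_node p i))).
  by rewrite (telescope_sumr (f \o tp_node p)).
split=> [gf|/cvgrPdist_lt gf eps /gf[delta /= d0 sd]].
  apply/cvgrPdist_lt => eps /gf[delta d0 sd]; exists delta => //= p pf.
  rewrite /= -(sumE p delta pf); case: pf => ta tc pf.
  exact: (sd (tp_size p) (tp_node p) (tp_tag p)).
exists delta => // m t xi ta tc txi.
have pf : is_fine a c delta (TaggedPartition m t xi) by split.
by have := sd _ pf; rewrite /= -(sumE _ delta pf).
Qed.

Lemma riemann_integrableE a c g : a < c ->
  riemann_integrable a c g <-> cvg (riemann_sum g p @[p --> fine_filter a c]).
Proof.
move=> ac; split=> [[f /riemann_primitiveE gf]|/cvg_ex[/= l gl]].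
  by apply/cvg_ex; exists (f c - f a).
exists (fun t => if t == c then l else 0); apply/riemann_primitiveE.
by rewrite eqxx (lt_eqF ac) subr0.
Qed.

Lemma riemann_integralE a c g (l : E) : a < c ->
  riemann_sum g p @[p --> fine_filter a c] --> l -> riemann_integral a c g = l.
Proof.
move=> ac gl; have FF := fine_filter_proper ac.
have : [set f c - f a | f in riemann_primitive a c g] (riemann_integral a c g).
  apply: xgetPex; exists l, (fun t => if t == c then l else 0).
    by apply/riemann_primitiveE; rewrite eqxx (lt_eqF ac) subr0.
  by rewrite eqxx (lt_eqF ac) subr0.
move=> [f /riemann_primitiveE gf <-].
by apply: (@cvg_unique _ (@norm_hausdorff _ _) _ _ _ _ gf gl).
Qed.

Lemma riemann_integralP a c g : a < c -> riemann_integrable a c g ->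
  riemann_sum g p @[p --> fine_filter a c] --> riemann_integral a c g.
Proof.
by move=> ac /(riemann_integrableE g ac) /cvg_ex[l gl]; rewrite (riemann_integralE ac gl).
Qed.

Lemma riemann_integral0 a g : riemann_integral a a g = 0.
Proof. by rewrite /riemann_integral; case: xgetP => // _ -> [f _ <-]; rewrite subrr. Qed.

End SumEstimates.

(** * Integrability of bounded, right locally constant functions *)

Section Boundedness.
Context {R : realType} {E : normedModType R}.
Implicit Types (g : R -> E) (a c : R).

(** Moving the tag of one cell of an equidistant partition changes the Riemann
    sum by the step times the change of [g], while any two fine enough sums are
    close; so the oscillation of [g] on each cell is bounded, and there are
    finitely many cells. *)
Lemma riemann_integrable_bounded g a c : a < c -> riemann_integrable a c g ->
  exists M : R, forall t, a <= t < c -> `|g t| <= M.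
Proof.
move=> ac /(riemann_integralP ac) /cvgrPdist_lt /(_ 1 ltr01)[delta /= d0 gd].
have [N [h [hd hN]]] := fine_step ac d0; have /andP[h0 _] := hd.
exists (\sum_(i < N) `|g (a + i%:R * h)| + 2 / h) => t /andP[at_ tc].
pose k := Num.trunc ((t - a) / h).
have /andP[] : k%:R <= (t - a) / h < k.+1%:R.
  by apply: truncn_itv; rewrite divr_ge0 ?subr_ge0 ?(ltW h0).
rewrite ler_pdivlMr// ltr_pdivrMr// => kt tk.
have kN : (k < N)%N by rewrite -(ltr_nat R) -(ltr_pM2r h0); lra.
pose xi i := if i == k then t else a + i%:R * h.
have leftE i : a + i%:R * h <= a + i%:R * h <= a + i.+1%:R * h.
  by rewrite lexx /= -natr1; lra.
have /gd lf : is_fine a c delta (left_tagged a h N).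
  exact: fine_equidistant hd hN (fun i _ => leftE i).
have /gd mf : is_fine a c delta (TaggedPartition N (fun i => a + i%:R * h) xi).
  apply: fine_equidistant => // i _; rewrite /xi; case: eqVneq => [->|_ //].
  by apply/andP; split; lra.
have dE : riemann_sum g (TaggedPartition N (fun i => a + i%:R * h) xi)
    - riemann_sum g (left_tagged a h N) = h *: (g t - g (a + k%:R * h)).
  rewrite -sumrB (bigD1 (Ordinal kN)) //= big1 ?addr0 => [|i]; last first.
    by rewrite -val_eqE /= /xi => /negPf ->; rewrite subrr.
  by rewrite /xi eqxx -scalerBr -natr1; congr (_ *: _); ring.
have : `|h *: (g t - g (a + k%:R * h))| <= 2.
  rewrite -dE -(subrKA (riemann_integral a c g)) (le_trans (ler_normD _ _))//.
  by rewrite distrC -[2]/(1 + 1) lerD// ltW.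
rewrite normrZ gtr0_norm// mulrC -ler_pdivlMr// => osc.
have -> : g t = g (a + k%:R * h) + (g t - g (a + k%:R * h)) by rewrite addrC subrK.
apply: (le_trans (ler_normD _ _)); apply: lerD => //.
by rewrite (bigD1 (Ordinal kN)) //= lerDl sumr_ge0.
Qed.

End Boundedness.

(** The indicator function of the values below [s], as a function into [R^o] so
    that Riemann sums apply to it. *)
Definition below {R : realType} (s x : R) : R^o := (x < s)%R%:R.

(** On one cell, the increment of [min s] and the term of the Riemann sum both lie
    between the products of the length with the two end values of the monotone
    function [below s]; the lengths are less than [2 * delta], and the end values
    telescope to at most [1]. *)
Lemma below_primitive {R : realType} (a c s : R) :
  riemann_primitive a c (below s) (Num.min s : R -> R^o).
Proof.
move=> eps e0; exists (eps / 4); first by lra.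
move=> m t xi ta tc txi; apply: le_lt_trans (_ : eps / 2 < _); last by lra.
apply: (le_trans (ler_norm_sum _ _ _)).
have cell (i : 'I_m) : true ->
    `|Num.min s (t i.+1) - Num.min s (t i) - (t i.+1 - t i) *: below s (xi i)|
    <= eps / 2 * ((t i < s)%R%:R - (t i.+1 < s)%R%:R).
  move=> _; have [tt /andP[tx xt] [dt td]] := txi i (ltn_ord i).
  rewrite /below /= /GRing.scale /=.
  case: (ltP s (t i.+1)); case: (ltP s (t i)); case: (ltP (xi i) s);
    case: (ltP (t i) s); case: (ltP (t i.+1) s) => //= *;
    rewrite ler_norml; apply/andP; split; lra.
apply: (le_trans (ler_sum _ cell)).
rewrite -mulr_sumr -(big_mkord xpredT (fun i => (t i < s)%R%:R - (t i.+1 < s)%R%:R)).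
rewrite (telescope_sumr_eq (fun i => - (t i < s)%R%:R))//; last first.
  by move=> k _; rewrite opprK addrC.
rewrite ler_piMr; [by []|lra|].
by rewrite opprK; case: (t m < s); case: (t 0%N < s) => /=; lra.
Qed.

Section Integrability.
Context {R : realType}.
Implicit Types (a c s t : R).

Lemma cvg_riemann_sum_below a c s : a <= s <= c ->
  riemann_sum (below s) p @[p --> fine_filter a c] --> (s - a : R^o).
Proof.
move=> /andP[as_ sc]; have /riemann_primitiveE := below_primitive a c s.
by rewrite (min_l sc) (min_r as_).
Qed.

Lemma eq_cvg_riemann_sum (E : normedModType R) (g h : R -> E) a c :
  (forall t, a <= t <= c -> g t = h t) ->
  cvg (riemann_sum g p @[p --> fine_filter a c]) ->
  cvg (riemann_sum h p @[p --> fine_filter a c]).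
Proof.
move=> gh /cvg_ex[l gl]; apply/cvg_ex; exists l.
apply: cvg_trans gl; apply: near_eq_cvg; exists 1 => //= p pf.
exact: eq_riemann_sum pf gh.
Qed.

Lemma is_cvg_riemann_sumD (E : normedModType R) (g h : R -> E) a c :
  cvg (riemann_sum g p @[p --> fine_filter a c]) ->
  cvg (riemann_sum h p @[p --> fine_filter a c]) ->
  cvg (riemann_sum (g \+ h) p @[p --> fine_filter a c]).
Proof.
move=> /cvg_ex[l gl] /cvg_ex[l' gl']; apply/cvg_ex; exists (l + l').
under eq_fun do rewrite riemann_sumD.
exact: cvgD gl gl'.
Qed.

Lemma cvg_riemann_sum_belowB (E : normedModType R) (w : E) a c s t :
  a <= t <= c -> a <= s <= c ->
  riemann_sum (fun x => (below s x - below t x) *: w) p @[p --> fine_filter a c]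
    --> (s - t) *: w.
Proof.
move=> tac sac; under eq_fun do rewrite riemann_sumZ riemann_sumB.
apply: cvgZr_tmp; have -> : s - t = (s - a) - (t - a) :> R^o by ring.
exact: cvgB (cvg_riemann_sum_below sac) (cvg_riemann_sum_below tac).
Qed.

Context {E : completeNormedModType R}.
Implicit Types (g h : R -> E).

(** The Riemann sums of [g] stay close to the limit of those of [h], which gives the
    Cauchy property; completeness of [E] does the rest. *)
Lemma is_cvg_riemann_sum_approx g a c : a < c ->
  (forall eps, 0 < eps -> exists2 h,
     cvg (riemann_sum h p @[p --> fine_filter a c]) &
     \forall p \near fine_filter a c, `|riemann_sum g p - riemann_sum h p| < eps) ->
  cvg (riemann_sum g p @[p --> fine_filter a c]).
Proof.
move=> ac gh; have FF := fine_filter_proper ac.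
apply: cauchy_cvg; apply: cauchy_exP => eps e0.
have e20 : 0 < eps / 2 by lra.
have [h /cvg_ex[/= l hl] hg] := gh _ e20; exists l.
move/cvgrPdist_lt : hl => /(_ _ e20) hl.
near=> p; rewrite -ball_normE /= -(subrKA (riemann_sum h p)).
rewrite (le_lt_trans (ler_normD _ _))// (splitr eps) ltrD//; first by near: p.
by rewrite distrC; near: p.
Unshelve. all: by end_near. Qed.

End Integrability.

(** The truncations of [g] to the left of [s] are integrable for all [s] from [a]
    to [c]: if [s] is the supremum of the good values, then [s] is good, since
    truncating at a slightly smaller good value costs at most the bound of [g] times
    the gap; and beyond a good [s < c] the function [g] is constant for a
    while, so that only a multiple of an indicator function is added. *)
Theorem right_locally_constant_integrable {R : realType}
    {E : completeNormedModType R} (g : R -> E) (a c M : R) : a < c ->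
  (forall t, a <= t < c -> `|g t| <= M) ->
  (forall t, a <= t < c -> exists2 s, t < s & forall x, t <= x < s -> g x = g t) ->
  riemann_integrable a c g.
Proof.
move=> ac gM gc; apply/riemann_integrableE => //.
have FF := fine_filter_proper ac.
pose P s := cvg (riemann_sum (fun x => below s x *: g x) p @[p --> fine_filter a c]).
pose A := [set s | a <= s <= c /\ P s].
have aA : A a.
  split; first by rewrite lexx ltW.
  apply: (@eq_cvg_riemann_sum R E (cst 0)) => [t /andP[ta _]|].
    by rewrite /below ltNge ta scale0r.
  apply/cvg_ex; exists 0; apply: cvg_near_cst; exists 1 => //= p pf.
  by rewrite (riemann_sum_cst _ pf) scaler0.
have Aub : has_ubound A by exists c => s [/andP[]].
have Asup : has_sup A by split=> //; exists a.
set s := sup A.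
have sac : a <= s <= c.
  by rewrite (ub_le_sup Aub aA)/=; apply: ge_sup; [exists a|move=> s' [/andP[]]].
have Ps : P s.
  apply: is_cvg_riemann_sum_approx => // eps e0.
  have M0 : 0 <= M by apply: le_trans (gM a _); rewrite ?lexx.
  (* [M] may be zero, hence the denominator [M + 1] *)
  have [|t [tac Pt] st] := @sup_adherent _ A (eps / (M + 1)) _ Asup.
    by rewrite divr_gt0//; lra.
  have ts : t <= s by apply: ub_le_sup.
  exists (fun x => below t x *: g x) => //.
  have Mst : (s - t) * M < eps.
    have : s - t < eps / (M + 1) by rewrite -/s in st; lra.
    rewrite ltr_pdivlMr; last by lra.
    by apply: le_lt_trans; rewrite ler_wpM2l; lra.
  have := cvgr_lt _ (@cvg_riemann_sum_belowB R R^o M _ _ _ _ tac sac) _ Mst.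
  have near_fine : \forall p \near fine_filter a c, is_fine a c 1 p by exists 1 => /=.
  move=> /(_ (fine_filter_filter a c)) bound.
  move: near_fine bound; apply: filterS2 => p pf; apply: le_lt_trans.
  rewrite -riemann_sumB; apply: (le_norm_riemann_sum pf) => i ip /=.
  move: (tp_tag p i) (fine_tag pf ip) => x /andP[ax _].
  rewrite -scalerBl normrZ /below; case: (ltP x s) => xs.
    have gx : `|g x| <= M by rewrite gM// ax /=; move: sac => /andP[_]; apply: lt_le_trans.
    case: (ltP x t) => _ /=; first by rewrite subrr normr0 mul0r scale0r.
    by rewrite subr0 normr1 mul1r scale1r.
  by rewrite ltNge (le_trans ts xs) /= subrr normr0 mul0r scale0r.
have sc : s = c.
  move: sac => /andP[as_]; rewrite le_eqVlt => /orP[/eqP//|sc].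
  have [s' ss' gs] := gc s (introT andP (conj as_ sc)).
  suff /(ub_le_sup Aub) : A (Num.min s' c) by rewrite -/s leNgt lt_min ss' sc.
  have s1ac : a <= Num.min s' c <= c.
    by rewrite ge_min lexx orbT andbT le_min (ltW ac) (le_trans as_ (ltW ss')).
  split=> //.
  apply: (@eq_cvg_riemann_sum R E ((fun x => below s x *: g x) \+
     (fun x => (below (Num.min s' c) x - below s x) *: g s))) => [x _ /=|].
    rewrite /below; case: (ltP x s) => xs.
      have -> : x < Num.min s' c by rewrite lt_min (lt_trans xs ss') (lt_trans xs sc).
      by rewrite subrr scale0r addr0.
    rewrite scale0r add0r subr0; case: (ltP x (Num.min s' c)); rewrite ?scale0r//.
    by rewrite lt_min => /andP[xs' _]; rewrite (gs x)// xs.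
  apply: is_cvg_riemann_sumD => //; apply/cvg_ex; exists ((Num.min s' c - s) *: g s).
  by apply: cvg_riemann_sum_belowB; rewrite // as_ ltW.
(* the value at [c], which the hypotheses leave free, is added on the cells tagged at [c] *)
apply: (@eq_cvg_riemann_sum R E ((fun x => below c x *: g x) \+
   (cst (g c) \- (fun x => (below c x - below a x) *: g c)))) => [x /andP[ax xc] /=|].
  rewrite /below (ltNge x a) ax subr0; case: ltgtP xc => //= [_ _|-> _].
    by rewrite !scale1r subrr addr0.
  by rewrite !scale0r subr0 add0r.
apply: is_cvg_riemann_sumD; first by move: Ps; rewrite sc.
apply/cvg_ex; exists ((c - a) *: g c - (c - a) *: g c).
under eq_fun do rewrite riemann_sumB.
apply: cvgB; last by apply: cvg_riemann_sum_belowB; rewrite ?lexx ?ltW.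
by apply: cvg_near_cst; exists 1 => //= p pf; rewrite (riemann_sum_cst _ pf).
Qed.

(** * Additivity and estimates of the integral *)

Definition concat {R : realType} (p q : tagged_partition R) : tagged_partition R :=
  let m := tp_size p in
  TaggedPartition (m + tp_size q)
    (fun i => if (i <= m)%N then tp_node p i else tp_node q (i - m))
    (fun i => if (i < m)%N then tp_tag p i else tp_tag q (i - m)).

Lemma tp_node_concatD {R : realType} (p q : tagged_partition R) (j : nat) :
  tp_node p (tp_size p) = tp_node q 0%N ->
  tp_node (concat p q) (tp_size p + j) = tp_node q j.
Proof.
move=> pq /=; rewrite addKn -[X in (_ <= X)%N]addn0 leq_add2l leqn0.
by case: eqP => // ->; rewrite addn0.
Qed.

Lemma tp_tag_concatD {R : realType} (p q : tagged_partition R) (j : nat) :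
  tp_tag (concat p q) (tp_size p + j) = tp_tag q j.
Proof. by rewrite /= ltnNge leq_addr addKn. Qed.

Lemma is_fine_concat {R : realType} (a m c delta : R) (p q : tagged_partition R) :
  is_fine a m delta p -> is_fine m c delta q -> is_fine a c delta (concat p q).
Proof.
move=> [p0 pm pf] [q0 qc qf]; have pq : tp_node p (tp_size p) = tp_node q 0%N.
  by rewrite pm q0.
split; [exact: p0|by rewrite tp_node_concatD|move=> i im].
case: (ltnP i (tp_size p)) => [ip|/subnKC ij].
  by rewrite /= ip (ltnW ip); exact: pf.
move: im; rewrite -ij ltn_add2l => jq.
by rewrite -addnS !tp_node_concatD// tp_tag_concatD; apply: qf.
Qed.

Lemma cvg_concat {R : realType} (a m c : R) :
  concat pq.1 pq.2 @[pq --> (fine_filter a m, fine_filter m c)] --> fine_filter a c.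
Proof.
move=> A [delta /= d0 sA]; exists (is_fine a m delta, is_fine m c delta) => /=.
  by split; exists delta.
by move=> [p q] /= [pf qf]; apply: sA; exact: is_fine_concat pf qf.
Qed.

Section IntegralEstimates.
Context {R : realType} {E : normedModType R}.
Implicit Types (g : R -> E) (a m c : R).

Lemma riemann_sum_concat g a m c delta p q :
  is_fine a m delta p -> is_fine m c delta q ->
  riemann_sum g (concat p q) = riemann_sum g p + riemann_sum g q.
Proof.
move=> [_ pm _] [q0 _ _]; rewrite /riemann_sum big_split_ord; congr (_ + _).
  by apply: eq_bigr => i _ /=; rewrite (ltnW (ltn_ord i)) ltn_ord.
by apply: eq_bigr => i _; rewrite -addnS !tp_node_concatD ?pm// tp_tag_concatD.
Qed.

(** Juxtaposing fine partitions of [[a, m]] and [[m, c]] gives a fine partition of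
    [[a, c]], so the sum of the two integrals is also a limit of Riemann sums on
    [[a, c]]. *)
Lemma riemann_integralD g a m c : a < m < c ->
  riemann_integrable a m g -> riemann_integrable m c g ->
  riemann_integrable a c g ->
  riemann_integral a c g = riemann_integral a m g + riemann_integral m c g.
Proof.
move=> /andP[am mc] gam gmc gac; have ac := lt_trans am mc.
have FF1 := fine_filter_proper am; have FF2 := fine_filter_proper mc.
pose F := filter_prod (fine_filter a m) (fine_filter m c).
have cvg1 : riemann_sum g (concat pq.1 pq.2) @[pq --> F] --> riemann_integral a c g.
  exact: cvg_comp (@cvg_concat R a m c) (riemann_integralP ac gac).
have cvg2 : riemann_sum g (concat pq.1 pq.2) @[pq --> F]
    --> riemann_integral a m g + riemann_integral m c g.
  have cvg1p : riemann_sum g pq.1 @[pq --> F] --> riemann_integral a m g.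
    exact: cvg_comp cvg_fst (riemann_integralP am gam).
  have cvg2p : riemann_sum g pq.2 @[pq --> F] --> riemann_integral m c g.
    exact: cvg_comp cvg_snd (riemann_integralP mc gmc).
  apply: cvg_trans (cvgD cvg1p cvg2p).
  apply: near_eq_cvg; exists (is_fine a m 1, is_fine m c 1) => /=.
    by split; exists 1 => /=.
  by move=> [p q] /= [pf qf]; exact/esym/(riemann_sum_concat g pf qf).
exact: (@cvg_unique _ (@norm_hausdorff _ _) _ _ _ _ cvg1 cvg2).
Qed.

(** The integral is approached by sums with left tags, and these never see the value
    at the right end point [c]. *)
Lemma le_riemann_integral_dist g m c (w : E) (M : R) : m < c ->
  riemann_integrable m c g -> (forall t, m <= t < c -> `|g t - w| <= M) ->
  `|riemann_integral m c g - (c - m) *: w| <= M * (c - m).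
Proof.
move=> mc gi gw; apply/ler_addgt0Pr => eps e0.
have /cvgrPdist_lt /(_ _ e0)[delta /= d0 gd] := riemann_integralP mc gi.
have [N [h pf]] := fine_left_tagged mc d0.
have /= /ltW Ip := gd _ pf; have Mk : M * (c - m) = riemann_sum (cst M : R -> R^o)
    (left_tagged m h N) by rewrite (riemann_sum_cst _ pf) mulrC.
rewrite -(subrKA (riemann_sum g (left_tagged m h N))) addrC.
rewrite (le_trans (ler_normD _ _))// lerD//.
rewrite Mk -(riemann_sum_cst w pf) -riemann_sumB; apply: (le_norm_riemann_sum pf).
move=> i iN; apply: gw; have [_ _ /(_ i iN)[ti _ _]] := pf.
have /andP[mi _] := fine_node pf (ltnW iN); have /andP[_ ic] := fine_node pf iN.
by apply/andP; split; [exact: mi|exact: lt_le_trans ti ic].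
Qed.

End IntegralEstimates.

(** * Uniqueness of transfinite sums *)

Section TransfiniteSums.
Context {R : realType} {E : normedModType R}.
Implicit Types (A : set R) (x : R -> E) (sigma : \bar R -> E) (gamma : \bar R).

(** The three clauses of [transfinite_sums] at a single index: this form can be
    used for functions of which the behaviour at the supremum is not yet known. *)
Definition transfinite_sum_at A x sigma gamma : Prop :=
  [/\ gamma = ereal_inf (EFin @` A) -> sigma gamma = 0,
      forall beta : R, A beta -> is_succ (EFin @` A) beta%:E gamma ->
        sigma gamma = sigma beta%:E + x beta
    & (ereal_inf (EFin @` A) < gamma)%E ->
      ~ (exists2 beta, A beta & is_succ (EFin @` A) beta%:E gamma) ->
      forall eps : R, 0 < eps ->
      exists beta_eps : R, [/\ A beta_eps, (beta_eps%:E < gamma)%E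
        & forall beta : R, A beta -> beta_eps <= beta -> (beta%:E < gamma)%E ->
          `|sigma beta%:E - sigma gamma| < eps]].

(** The least element is what makes the infimum belong to [A], so that the first clause
    is one of the conditions on the right. *)
Lemma transfinite_sumsP A x sigma : (exists m, is_least A m) ->
  transfinite_sums (EFin @` A) x sigma <->
  forall gamma, (EFin @` A `|` [set ereal_sup (EFin @` A)]) gamma ->
    transfinite_sum_at A x sigma gamma.
Proof.
move=> [m [Am mA]].
have inf_in : (EFin @` A) (ereal_inf (EFin @` A)).
  exists m => //; apply/eqP; rewrite eq_le ereal_inf_lbound ?andbT; last by exists m.
  by apply: le_ereal_inf_tmp => _ [t At <-]; rewrite lee_fin mA.
have succE gamma : (exists2 beta, (EFin @` A) beta & is_succ (EFin @` A) beta gamma) <->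
    (exists2 beta : R, A beta & is_succ (EFin @` A) beta%:E gamma).
  split=> [[_ [beta Ab <-]]|[beta Ab]]; first by exists beta.
  by exists beta%:E => //; exists beta.
split=> [[s0 sS sL] gamma Lg|s].
  split=> [->//|beta Ab|infg nS eps e0]; first by apply: sS; exists beta.
  have nS' : ~ exists2 beta, (EFin @` A) beta & is_succ (EFin @` A) beta gamma.
    by move/succE.
  have [_ [[beta Ab <-] bg sb]] := sL gamma Lg infg nS' eps e0.
  exists beta; split => // beta' Ab' bb' bg'; apply: sb; first by exists beta'.
  by rewrite lee_fin bb'.
split=> [|beta gamma [b' Ab' [<-]] bg|gamma Lg infg nS eps e0].
- by have [s0 _ _] := s _ (or_introl inf_in); exact: s0.
- have Lg : (EFin @` A) gamma by case: bg => -[].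
  by have [_ sS _] := s gamma (or_introl Lg); exact: sS.
- have [_ _ /(_ infg (fun S => nS ((succE gamma).2 S)) eps e0)] := s gamma Lg.
  move=> [beta [Ab bg sb]].
  exists beta%:E; split => // _ [beta' Ab' <-].
  by rewrite lee_fin => /andP[bb' bg']; exact: sb.
Qed.

(** The value at an index is determined by the previous ones: by the recursion at a
    successor, and as a limit otherwise. *)
Lemma eq_transfinite_sum_at A x sigma sigma' gamma :
  (ereal_inf (EFin @` A) <= gamma)%E ->
  transfinite_sum_at A x sigma gamma -> transfinite_sum_at A x sigma' gamma ->
  (forall beta, A beta -> (beta%:E < gamma)%E -> sigma beta%:E = sigma' beta%:E) ->
  sigma gamma = sigma' gamma.
Proof.
move=> infg [s0 sS sL] [s'0 s'S s'L] ss'.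
move: infg; rewrite le_eqVlt => /orP[/eqP/esym infg|infg]; first by rewrite s0// s'0.
have [[beta Ab bg]|nS] := pselect (exists2 beta, A beta & is_succ (EFin @` A) beta%:E gamma).
  by rewrite (sS _ Ab)// (s'S _ Ab)// ss'//; case: bg => -[].
apply/eqP; rewrite -subr_eq0 -normr_le0; apply/ler_addgt0Pr => eps e0.
have e20 : 0 < eps / 2 by lra.
have [beta [Ab bg sb]] := sL infg nS _ e20.
have [beta' [Ab' bg' sb']] := s'L infg nS _ e20.
have [Am mg] : A (Num.max beta beta') /\ ((Num.max beta beta')%:E < gamma)%E.
  by case: (leP beta beta').
have := sb _ Am _ mg; rewrite le_max lexx => /(_ isT) h.
have := sb' _ Am _ mg; rewrite le_max lexx orbT => /(_ isT) h'.
rewrite add0r -(subrKA (sigma (Num.max beta beta')%:E)) (le_trans (ler_normD _ _))//.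
by rewrite distrC {2}(ss' _ Am mg) (splitr eps) lerD// ltW.
Qed.

Lemma eq_transfinite_sum A x sigma sigma' : well_ordered A ->
  (forall gamma : R, A gamma -> transfinite_sum_at A x sigma gamma%:E) ->
  (forall gamma : R, A gamma -> transfinite_sum_at A x sigma' gamma%:E) ->
  forall gamma : R, A gamma -> sigma gamma%:E = sigma' gamma%:E.
Proof.
move=> woA s s' gamma Ag; apply: contrapT => ss'.
have [||m [[Am sm] mleast]] := woA [set t | A t /\ sigma t%:E <> sigma' t%:E].
- by move=> t [].
- by exists gamma.
apply: sm; apply: (@eq_transfinite_sum_at A x) => [|||beta Ab]; [|exact: s|exact: s'|].
  by apply: ereal_inf_lbound; exists m.
rewrite lte_fin => bm; apply: contrapT => sb.
by have := mleast beta (conj Ab sb); rewrite leNgt bm.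
Qed.

End TransfiniteSums.

(** * Step functions on well ordered cells *)

Lemma bounded_onP {R : realType} {E : normedModType R} {T : Type} (f : T -> E)
    (B : set T) :
  [bounded f x | x in B] <-> exists M : R, forall x, B x -> `|f x| <= M.
Proof.
split=> [[M [_ fM]]|[M fM]]; first by exists (M + 1) => x; apply: fM; rewrite ltrDl.
by exists M; split; [exact: num_real|move=> M' MM' x /fM /le_trans; apply; exact: ltW].
Qed.

Section Cells.
Context {R : realType} (a : R) (b : \bar R) (L : set R).
Context (L_wo : well_ordered L).
Context (L_sub : L `<=` [set t | (a%:E <= t%:E < b)%E]).
Context (L_min : is_least L a).
Context (L_sup : ereal_sup (EFin @` L) = b).
Context (L_cover : [set t : R | (a%:E <= t%:E < b)%E]
  = \bigcup_(alpha in L) `[alpha, succ_in L alpha[%classic).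
Implicit Types (alpha beta t : R) (gamma : \bar R).

(** As [b] is the supremum of [L] and no element of [L], above every element there
    is another one, so that [succ_in] has its intended value. *)
Lemma succ_inP alpha : L alpha -> is_succ L alpha (succ_in L alpha).
Proof.
move=> La; apply: xgetPex; apply: L_wo; first by move=> t [].
have /andP[_] := L_sub La; rewrite -L_sup => /ereal_sup_gt[_ [t Lt <-]].
by rewrite lte_fin => at_; exists t.
Qed.

Lemma succ_in_mem alpha : L alpha -> L (succ_in L alpha).
Proof. by move=> /succ_inP[[]]. Qed.

Lemma lt_succ_in alpha : L alpha -> alpha < succ_in L alpha.
Proof. by move=> /succ_inP[[]]. Qed.

Lemma succ_in_le alpha beta : L alpha -> L beta -> alpha < beta -> succ_in L alpha <= beta.
Proof. by move=> /succ_inP[_ sl] Lb ab; apply: sl. Qed.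

Lemma min_le alpha : L alpha -> a <= alpha.
Proof. by move=> /L_sub /andP[]. Qed.

Lemma mem_lt_sup alpha : L alpha -> (alpha%:E < b)%E.
Proof. by move=> /L_sub /andP[]. Qed.

Lemma cell_of t : a <= t -> (t%:E < b)%E ->
  exists2 alpha, L alpha & alpha <= t < succ_in L alpha.
Proof.
move=> at_ tb; have : [set t : R | (a%:E <= t%:E < b)%E] t by rewrite /= lee_fin at_.
by rewrite L_cover => -[alpha La]; rewrite /= in_itv /=; exists alpha.
Qed.

Lemma ereal_infE : ereal_inf (EFin @` L) = a%:E.
Proof.
have [La al] := L_min; apply/eqP; rewrite eq_le ereal_inf_lbound /=; last by exists a.
by apply: le_ereal_inf_tmp => _ [t Lt <-]; rewrite lee_fin al.
Qed.

Lemma is_succ_EFin beta gamma : L beta ->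
  is_succ (EFin @` L) beta%:E gamma <-> gamma = (succ_in L beta)%:E.
Proof.
move=> Lb; split=> [[[[t Lt <-]]]|->].
  rewrite /= lte_fin => bt tl; congr _%:E; apply/eqP; rewrite eq_le succ_in_le// andbT.
  rewrite -lee_fin; apply: tl; split; last by rewrite /= lte_fin lt_succ_in.
  by exists (succ_in L beta) => //; exact: succ_in_mem.
split; first split; [by exists (succ_in L beta) => //; exact: succ_in_mem| |].
  by rewrite /= lte_fin lt_succ_in.
by move=> _ [[t Lt <-]] /=; rewrite lte_fin lee_fin => bt; exact: succ_in_le.
Qed.

(** If [t < gamma] lies in the cell of [alpha], then the successor of [alpha] is at
    most [gamma], and it is not [gamma]. *)
Lemma limit_approx gamma t : (EFin @` L `|` [set b]) gamma ->
  ~ (exists2 beta, L beta & is_succ (EFin @` L) beta%:E gamma) ->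
  a <= t -> (t%:E < gamma)%E -> exists beta, [/\ L beta, t < beta & (beta%:E < gamma)%E].
Proof.
move=> Lg nS at_ tg.
have gb : (gamma <= b)%E by case: Lg => [[r /mem_lt_sup/ltW ? <-]//|->].
have [alpha La /andP[alt tS]] := cell_of at_ (lt_le_trans tg gb).
exists (succ_in L alpha); split => //; first exact: succ_in_mem.
have {Lg} [[r Lr rg]|->] := Lg; last by apply: mem_lt_sup; exact: succ_in_mem.
rewrite -rg lte_fin lt_neqAle succ_in_le ?andbT//; last first.
  by rewrite -lte_fin rg (le_lt_trans _ tg)// lee_fin.
apply/eqP => Sr; apply: nS; exists alpha => //; apply/is_succ_EFin => //.
by rewrite -rg Sr.
Qed.

Context {E : completeNormedModType R} (z g : R -> E).
Context (g_cell : forall alpha t, L alpha -> alpha <= t < succ_in L alpha ->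
  g t = z alpha).

Lemma step_mem alpha : L alpha -> g alpha = z alpha.
Proof. by move=> La; apply: g_cell; rewrite // lexx lt_succ_in. Qed.

Lemma step_integrable m c (M : R) : a <= m < c -> (c%:E <= b)%E ->
  (forall t, m <= t < c -> `|g t| <= M) -> riemann_integrable m c g.
Proof.
move=> /andP[am mc] cb gM; apply: (right_locally_constant_integrable mc gM).
move=> t /andP[mt tc].
have [|alpha La /andP[alt tS]] := cell_of (le_trans am mt).
  by apply: lt_le_trans cb; rewrite lte_fin.
exists (succ_in L alpha) => // x /andP[tx xS].
by rewrite (g_cell La) ?(le_trans alt tx)// (g_cell La)// alt.
Qed.

Lemma step_integrable_bounded c : b = c%:E ->
  riemann_integrable a c g <-> [bounded z alpha | alpha in L].
Proof.
move=> bc; have ac : a < c by rewrite -lte_fin -bc; case: L_min => /mem_lt_sup.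
split=> [/(riemann_integrable_bounded ac)[M gM]|/bounded_onP[M zM]].
  apply/bounded_onP; exists M => alpha La; rewrite -step_mem//; apply: gM.
  by rewrite min_le// -lte_fin -bc mem_lt_sup.
apply: (@step_integrable _ _ M); rewrite ?lexx ?bc// => t /andP[at_ tc].
have [|alpha La t_in] := cell_of at_; first by rewrite bc lte_fin.
by rewrite (g_cell La)// zM.
Qed.

(** * The improper integral and the transfinite sums *)

Context (b_infty : b = +oo%E).
Let I c := riemann_integral a c g.
Let term alpha := (succ_in L alpha - alpha) *: z alpha.

Definition locally_bounded : Prop :=
  forall c, a < c -> exists M : R, forall t, a <= t < c -> `|g t| <= M.

Lemma locally_boundedP : locally_bounded <->
  (forall gamma : R, L gamma ->
     [bounded z alpha | alpha in L `&` [set alpha | alpha < gamma]]).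
Proof.
split=> [gb gamma Lg|zb c ac].
  have := min_le Lg; rewrite le_eqVlt => /orP[/eqP <-|/gb[M gM]].
    by apply/bounded_onP; exists 0 => alpha [/min_le + /=]; rewrite leNgt => /negP.
  apply/bounded_onP; exists M => alpha [La /= ag].
  by rewrite -step_mem// gM// min_le.
have [_ [gamma Lg <-]] : exists2 y, (EFin @` L) y & (c%:E < y)%E.
  by apply: ereal_sup_gt; rewrite L_sup b_infty ltry.
rewrite lte_fin => cg; have /bounded_onP[M zM] := zb _ Lg; exists M.
move=> t /andP[at_ tc]; have [|alpha La t_in] := cell_of at_; first by rewrite b_infty ltry.
rewrite (g_cell La)//; apply: zM; split => //=; apply: le_lt_trans (lt_trans tc cg).
by case/andP: t_in.
Qed.

Lemma locally_bounded_integrable m c : locally_bounded -> a <= m < c ->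
  riemann_integrable m c g.
Proof.
move=> gb /andP[am mc]; have [M gM] := gb c (le_lt_trans am mc).
apply: (@step_integrable _ _ M); rewrite ?am// ?b_infty ?leey// => t /andP[mt tc].
by rewrite gM// (le_trans am mt).
Qed.

(** Used with [M = 0] and [w] the value on a cell, this computes the integral over the
    cell; with [w = 0] it is a Lipschitz bound. *)
Lemma le_integral_dist m c (w : E) (M : R) : locally_bounded -> a <= m < c ->
  (forall t, m <= t < c -> `|g t - w| <= M) ->
  `|I c - I m - (c - m) *: w| <= M * (c - m).
Proof.
move=> gb /andP[am mc] gw; have int := locally_bounded_integrable gb.
have gac : riemann_integrable a c g by apply: int; rewrite lexx (le_lt_trans am mc).
have gmc : riemann_integrable m c g by apply: int; rewrite am.
have I_split : I c = I m + riemann_integral m c g.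
  move: am; rewrite le_eqVlt => /orP[/eqP <-|am].
    by rewrite /I riemann_integral0 add0r.
  by apply: riemann_integralD; rewrite ?am//; apply: int; rewrite lexx.
rewrite I_split [X in X - _ - _]addrC addrK; exact: le_riemann_integral_dist.
Qed.

Lemma integral_cell alpha c : locally_bounded -> L alpha ->
  alpha <= c <= succ_in L alpha -> I c = I alpha + (c - alpha) *: z alpha.
Proof.
move=> gb La /andP[]; rewrite le_eqVlt => /orP[/eqP <- _|ac cS].
  by rewrite subrr scale0r addr0.
have := @le_integral_dist alpha c (z alpha) 0 gb.
rewrite min_le// ac mul0r normr_le0 subr_eq0 => /(_ isT) dist0.
rewrite addrC; apply/eqP; rewrite -subr_eq dist0// => t /andP[at_ tc].
by rewrite (g_cell La) ?subrr ?normr0// at_ (lt_le_trans tc cS).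
Qed.

(** The recursion at a successor is [integral_cell]; at the other indices the limit
    clause is the continuity from the left given by the Lipschitz bound. *)
Lemma integral_sum_at (sigma : \bar R -> E) beta : locally_bounded ->
  (forall t, sigma t%:E = I t) -> L beta ->
  transfinite_sum_at L term sigma beta%:E.
Proof.
move=> gb sI Lb; split.
- by rewrite ereal_infE => -[->]; rewrite sI; exact: riemann_integral0.
- move=> alpha La /(is_succ_EFin _ La) ->; rewrite !sI.
  by apply: integral_cell => //; rewrite lexx ltW// lt_succ_in.
rewrite ereal_infE lte_fin => ab nS eps e0; have [M gM] := gb _ ab.
have M0 : 0 <= M by apply: le_trans (gM a _); rewrite ?lexx.
have Mpos : 0 < M + 1 by lra.
pose t := Num.max a (beta - eps / (M + 1)).
have [|||alpha [La ta ab']] := @limit_approx beta%:E t _ nS.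
- by left; exists beta.
- by rewrite le_max lexx.
- by rewrite lte_fin gt_max ab ltrBlDr ltrDl divr_gt0.
exists alpha; split => // s Ls als; rewrite lte_fin => sb; rewrite !sI distrC.
have := @le_integral_dist s beta 0 M gb; rewrite min_le// sb scaler0 subr0.
move=> /(_ isT) dist_le; apply: le_lt_trans (dist_le _) _ => [u /andP[su ub]|].
  by rewrite subr0 gM// (le_trans (min_le Ls) su).
have : beta - eps / (M + 1) < s.
  by apply: lt_le_trans als; move: ta; rewrite gt_max => /andP[].
rewrite ltrBlDr -ltrBlDl ltr_pdivlMr// mulrC; apply: le_lt_trans.
by rewrite ler_wpM2r; lra.
Qed.

Lemma integral_improperP :
  improper_riemann_integrable a g <-> locally_bounded /\ cvg (I c @[c --> +oo]).
Proof.
split=> -[gi gc]; split => // c ac; first exact: riemann_integrable_bounded (gi c ac).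
by apply: locally_bounded_integrable; rewrite ?lexx.
Qed.

Lemma not_succ_infty : ~ (exists2 beta, L beta & is_succ (EFin @` L) beta%:E +oo%E).
Proof. by move=> [beta Lb /(is_succ_EFin _ Lb)]. Qed.

(** The integral up to [beta], with its limit as value at infinity, is the function of
    partial sums. *)
Lemma cvg_integral_summable : locally_bounded -> cvg (I c @[c --> +oo]) ->
  wo_summable (EFin @` L) term.
Proof.
move=> gb /cvg_ex[/= l Il].
pose sigma gamma := if gamma is t%:E then I t else l.
have atL beta : L beta -> transfinite_sum_at L term sigma beta%:E.
  exact: integral_sum_at.
have at_infty : transfinite_sum_at L term sigma +oo%E.
  split=> [|beta Lb Sb|_ nS eps e0]; first by rewrite ereal_infE.
    by case: not_succ_infty; exists beta.
  move/cvgrPdist_lt : Il => /(_ _ e0)[K [_ IK]].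
  have [|||beta [Lb tb _]] := @limit_approx +oo%E (Num.max a K) _ nS.
  - by right; rewrite b_infty.
  - by rewrite le_max lexx.
  - by rewrite ltry.
  exists beta; split; rewrite ?ltry// => s _ bs _; rewrite distrC; apply: IK.
  by apply: lt_le_trans bs; move: tb; rewrite gt_max => /andP[].
have Lleast : exists m, is_least L m by exists a.
have sums : transfinite_sums (EFin @` L) term sigma.
  apply/(transfinite_sumsP _ _ Lleast) => _ [[beta Lb <-]|->]; first exact: atL.
  by rewrite L_sup b_infty.
exists sigma => // sigma' /(transfinite_sumsP _ _ Lleast) s'.
have eqL beta : L beta -> sigma' beta%:E = sigma beta%:E.
  move=> Lb; apply: (eq_transfinite_sum L_wo _ atL) => // t Lt; apply: s'.
  by left; exists t.
move=> gamma; rewrite inE => -[[beta Lb <-]|->]; first exact: eqL.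
rewrite L_sup b_infty; apply: (@eq_transfinite_sum_at _ _ L term) => //.
- by rewrite leey.
- by apply: s'; right; rewrite L_sup b_infty.
- by move=> beta Lb _; exact: eqL.
Qed.

(** Within a cell the integral interpolates linearly between the values at the end
    points of the cell, and balls are convex. *)
Lemma summable_cvg_integral : locally_bounded -> wo_summable (EFin @` L) term ->
  cvg (I c @[c --> +oo]).
Proof.
move=> gb [sigma /transfinite_sumsP s _].
have {}s := s (ex_intro _ a L_min).
have sI beta : L beta -> sigma beta%:E = I beta.
  move=> Lb; pose iota gamma := if gamma is t%:E then I t else 0.
  apply: (@eq_transfinite_sum _ _ L term sigma iota) => // t Lt.
    by apply: s; left; exists t.
  exact: integral_sum_at.
(* at infinity only the sums [sigma] are known to satisfy the limit clause *)
have [_ _ s_infty] : transfinite_sum_at L term sigma +oo%E.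
  by apply: s; right; rewrite L_sup b_infty.
apply/cvg_ex; exists (sigma +oo%E); apply/cvgrPdist_lt => eps e0.
have [|beta [Lb _ sb]] := s_infty _ not_succ_infty eps e0; first by rewrite ereal_infE ltry.
exists beta; split; first exact: num_real.
move=> c bc; have [|alpha La /andP[alc cS]] := cell_of (le_trans (min_le Lb) (ltW bc)).
  by rewrite b_infty ltry.
have bal : beta <= alpha.
  rewrite leNgt; apply/negP => alb; have := succ_in_le La Lb alb.
  by rewrite leNgt (lt_trans bc cS).
have := sb _ La bal (ltry _); rewrite (sI _ La) => near_alpha.
have bS : beta <= succ_in L alpha by rewrite (le_trans bal)// ltW// lt_succ_in.
have := sb _ (succ_in_mem La) bS (ltry _); rewrite (sI _ (succ_in_mem La)) => near_S.
have len0 : 0 < succ_in L alpha - alpha by rewrite subr_gt0 lt_succ_in.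
have [k [k0 k1 kE]] : exists k, [/\ 0 <= k, k < 1 & c - alpha = k * (succ_in L alpha - alpha)].
  exists ((c - alpha) / (succ_in L alpha - alpha)); split.
  - by rewrite divr_ge0 ?(ltW len0)// subr_ge0.
  - by rewrite ltr_pdivrMr// mul1r ltrD2r.
  - by rewrite divfK// gt_eqF.
have -> : sigma +oo%E - I c = - ((1 - k) *: (I alpha - sigma +oo%E)
    + k *: (I (succ_in L alpha) - sigma +oo%E)).
  rewrite (@integral_cell alpha c)// ?alc ?ltW//.
  rewrite (@integral_cell alpha (succ_in L alpha))//; last by rewrite lexx ltW// lt_succ_in.
  rewrite kE -scalerA.
  move: (I alpha) (sigma _) (_ *: z alpha) => x l y.
  rewrite scalerBl scale1r [x + y - l]addrAC [_ *: (_ - _ + y)]scalerDr addrA subrK.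
  by rewrite !opprD opprK addrA [- x + l]addrC.
rewrite normrN (le_lt_trans (ler_normD _ _))// !normrZ (ger0_norm k0) gtr0_norm ?subr_gt0//.
have -> : eps = (1 - k) * eps + k * eps by ring.
by rewrite ltr_leD// ?ler_wpM2l ?ltr_pM2l ?subr_gt0// ltW.
Qed.

End Cells.

Unset Implicit Arguments.

Theorem proposition3p5 (R : realType) (E : completeNormedModType R)
    (a : R) (b : \bar R) (L : set R)
    (hab : (a%:E < b)%E)
    (hL : well_ordered L)
    (hsub : L `<=` [set t | (a%:E <= t%:E < b)%E])
    (hmin : is_least L a)
    (hsup : ereal_sup (EFin @` L) = b)
    (hcover : [set t : R | (a%:E <= t%:E < b)%E]
              = \bigcup_(alpha in L) `[alpha, succ_in L alpha[%classic)
    (hdisj : trivIset L (fun alpha => `[alpha, succ_in L alpha[%classic))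
    (z : R -> E) (g : R -> E)
    (hg : forall alpha t, L alpha -> alpha <= t < succ_in L alpha ->
          g t = z alpha) :
  (forall c : R, b = c%:E ->
     (riemann_integrable a c g <-> [bounded z alpha | alpha in L]))
  /\
  (b = +oo%E ->
     (improper_riemann_integrable a g <->
      (forall gamma, L gamma ->
         [bounded z alpha | alpha in L `&` [set alpha | alpha < gamma]])
      /\ wo_summable (EFin @` L)
           (fun alpha => (succ_in L alpha - alpha) *: z alpha))).
Proof.
split=> [c bc|binf].
  exact: (step_integrable_bounded hL hsub hmin hsup hcover hg bc).
apply: iff_trans (integral_improperP hcover hg binf) _.
have bddP := locally_boundedP hL hsub hsup hcover hg binf.
split=> [[gb gc]|[/bddP gb gs]]; split=> //.
- exact/bddP.
- exact: (cvg_integral_summable hL hsub hmin hsup hcover hg binf gb gc).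
- exact: (summable_cvg_integral hL hsub hmin hsup hcover hg binf gb gs).
Qed.
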